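(* Let $\mathcal A_1=\mathcal A(\tilde B_1)$ and $\mathcal A_2=\mathcal A(\tilde B_2)$ be locally acyclic cluster varieties, where $\tilde B_1=\begin{pmatrix}B\\C_1\end{pmatrix}$ and $\tilde B_2=\begin{pmatrix}B\\C_2\end{pmatrix}$ are extended exchange matrices of sizes $(n+m_1)\times n$ and $(n+m_2)\times n$, respectively, with the same $n\times n$ principal part $B$. Assume moreover that the integer spans of the rows of $\tilde B_1$ and of $\tilde B_2$ coincide. Then $\mathcal A_1$ has no mysterious points if and only if $\mathcal A_2$ has no mysterious points.
   Context: An extended exchange matrix is an $(n+m)\times n$ integer matrix $\tilde B=(b_{ij})$ whose top $n\times n$ block (principal part) is skew-symmetric; indices $1,\dots,n$ are mutable and $n+1,\dots,n+m$ frozen; it corresponds to an ice quiver. A seed is a pair $(\tilde{\mathbf x},\tilde B)$ with $\tilde{\mathbf x}=(x_1,\dots,x_{n+m})$ a free generating set of $\mathcal F=\mathbb{C}(x_1,\dots,x_{n+m})$. Mutation at $k\le n$ performs matrix (quiver) mutation and replaces $x_k$ by $x_k^{-1}\big(\prod_{b_{ik}>0}x_i^{b_{ik}}+\prod_{b_{ik}<0}x_i^{-b_{ik}}\big)$. The cluster algebra $A=A(\tilde B)$ is the $\mathbb{C}[x_{n+1}^{\pm1},\dots,x_{n+m}^{\pm1}]$-subalgebra of $\mathcal F$ generated by all cluster variables of all seeds $\Sigma(A)$ obtained by iterated mutation; $\mathcal A(\tilde B)=\operatorname{Spec}A$. The cluster torus $T(t)$, $t\in\Sigma(A)$, is the open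 locus in $\mathcal A$ where all variables of $t$ are nonzero; the deep locus is $\mathcal D(\mathcal A)=\mathcal A\setminus\bigcup_tT(t)$. $\operatorname{Aut}(A)$ is the group of algebra automorphisms sending every (mutable or frozen) cluster variable to a nonzero scalar multiple of itself; $\mathcal S(\mathcal A)$ is the set of points of $\mathcal A$ with nontrivial $\operatorname{Aut}(A)$-stabilizer. Always $\mathcal S(\mathcal A)\subseteq\mathcal D(\mathcal A)$; $\mathcal A$ has no mysterious points if $\mathcal S(\mathcal A)=\mathcal D(\mathcal A)$. A cluster algebra is acyclic if some seed has mutable quiver without oriented cycles. Given a seed and a set $S$ of mutable indices, let $A_S$ be the cluster algebra of the seed obtained by declaring the indices in $S$ frozen; if $A_S=A[x_i^{-1}:i\in S]$, then $\mathcal A_S=\operatorname{Spec}A_S$ is an open subset of $\mathcal A$ (cluster localization). $\mathcal A$ is locally acyclic if it has a finite covering by such $\mathcal A_S$ with $A_S$ acyclic. *)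

(* Defs.v *)
From HB Require Import structures.
From mathcomp Require Import all_boot all_order all_algebra.
From mathcomp Require Import boolp classical_sets reals.
From mathcomp.real_closed Require Import complex.
From mathcomp.multinomials Require Import mpoly.

Set Implicit Arguments.
Unset Strict Implicit.
Unset Printing Implicit Defensive.

Import Order.TTheory GRing.Theory Num.Theory.
Local Open Scope ring_scope.

(* The field K(x_0, ..., x_(N-1)); the alias carries its K-algebra structure. *)
Definition ratfun (K : fieldType) (N : nat) : Type := {fraction {mpoly K[N]}}.

Section RatFun.
Variables (K : fieldType) (N : nat).

HB.instance Definition _ := GRing.Field.on (ratfun K N).

Definition ratfun_const (c : K) : ratfun K N := tofrac c%:MP_[N].

Definition ratfun_var (i : 'I_N) : ratfun K N := tofrac ('X_i : {mpoly K[N]}).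

Definition ratfun_scale (c : K) (f : ratfun K N) : ratfun K N :=
  ratfun_const c * f.

Fact ratfun_scaleA a b f :
  ratfun_scale a (ratfun_scale b f) = ratfun_scale (a * b) f.
Proof. by rewrite /ratfun_scale /ratfun_const !rmorphM mulrA. Qed.

Fact ratfun_scale1 : left_id 1 ratfun_scale.
Proof. by move=> f; rewrite /ratfun_scale /ratfun_const !rmorph1 mul1r. Qed.

Fact ratfun_scaleDr : right_distributive ratfun_scale +%R.
Proof. by move=> a f g; rewrite /ratfun_scale mulrDr. Qed.

Fact ratfun_scaleDl f : {morph ratfun_scale^~ f : a b / a + b}.
Proof. by move=> a b; rewrite /ratfun_scale /ratfun_const !rmorphD mulrDl. Qed.

HB.instance Definition _ := GRing.Zmodule_isLmodule.Build K (ratfun K N)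
  ratfun_scaleA ratfun_scale1 ratfun_scaleDr ratfun_scaleDl.

Fact ratfun_scaleAl (c : K) (f g : ratfun K N) : c *: (f * g) = c *: f * g.
Proof. exact: mulrA. Qed.

HB.instance Definition _ :=
  GRing.Lmodule_isLalgebra.Build K (ratfun K N) ratfun_scaleAl.
HB.instance Definition _ := GRing.Lalgebra_isComAlgebra.Build K (ratfun K N).

End RatFun.

Section Subalgebra.
Variables (K : fieldType) (F : comAlgType K) (G : set F).

(* The smallest K-subalgebra of F that contains G. *)
Definition gen_subalg : {pred F} := fun x =>
  `[< forall P : {pred F}, GRing.subalg_closed P ->
        (forall y, G y -> y \in P) -> x \in P >].

Lemma gen_subalgP x :
  reflect (forall P : {pred F}, GRing.subalg_closed P ->
             (forall y, G y -> y \in P) -> x \in P)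
          (x \in gen_subalg).
Proof. exact: asboolP. Qed.

Lemma mem_gen_subalg x : G x -> x \in gen_subalg.
Proof. by move=> Gx; apply/gen_subalgP => P _; apply. Qed.

Fact gen_subalg_closed : GRing.subalg_closed gen_subalg.
Proof.
split.
- by apply/gen_subalgP => P [].
- move=> a u v /gen_subalgP Hu /gen_subalgP Hv; apply/gen_subalgP => P cP GP.
  by case: (cP) => _ + _; apply; [apply: Hu | apply: Hv].
- move=> u v /gen_subalgP Hu /gen_subalgP Hv; apply/gen_subalgP => P cP GP.
  by case: (cP) => _ _; apply; [apply: Hu | apply: Hv].
Qed.

HB.instance Definition _ :=
  GRing.isSubalgClosed.Build K F gen_subalg
    (GRing.subalg_closed_semi gen_subalg_closed).

Record gen_subalg_of : Type :=
  GenSubalg { gen_subalg_val : F; _ : gen_subalg_val \in gen_subalg }.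

HB.instance Definition _ := [isSub for gen_subalg_val].
HB.instance Definition _ := [Choice of gen_subalg_of by <:].
HB.instance Definition _ :=
  [SubChoice_isSubComNzRing of gen_subalg_of by <:].
HB.instance Definition _ := [SubZmodule_isSubLmodule of gen_subalg_of by <:].
HB.instance Definition _ :=
  [SubNzRing_SubLmodule_isSubLalgebra of gen_subalg_of by <:].
HB.instance Definition _ := [SubLalgebra_isSubAlgebra of gen_subalg_of by <:].

End Subalgebra.

(* The indices of a seed live in 'I_(n + m): [lshift m k] with k : 'I_n is the k-th
   (by default mutable) index and [rshift n j] with j : 'I_m is always frozen.
   Freezing further indices S does not reindex the seed: they are recorded in
   [sfrozen], and the columns of [sexch] indexed by S are then dead, since
   mutation at k only reads column k to update the other columns, and the
   mutable quiver only looks at the columns outside S. *)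
Record seed (F : Type) (n m : nat) : Type := Seed {
  svar : 'I_(n + m) -> F;
  sexch : 'M[int]_(n + m, n);
  sfrozen : {set 'I_n} }.

Definition initial_seed (K : fieldType) (n m : nat) (B : 'M[int]_(n + m, n)) :
    seed (ratfun K (n + m)) n m :=
  Seed (@ratfun_var K (n + m)) B finset.set0.

Definition pos_part (a : int) : int := Num.max a 0.

Definition mutate_mx (n m : nat) (k : 'I_n) (B : 'M[int]_(n + m, n)) :
    'M[int]_(n + m, n) :=
  \matrix_(i, j)
    if (i == lshift m k) || (j == k) then - B i j
    else B i j + pos_part (B i k) * pos_part (B (lshift m k) j)
               - pos_part (- B i k) * pos_part (- B (lshift m k) j).

Section Seeds.
Variables (F : fieldType) (n m : nat).
Implicit Types (t : seed F n m) (k : 'I_n) (S : {set 'I_n}).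

Definition mutate_var t k : F :=
  (svar t (lshift m k))^-1 *
    (\prod_(i | 0 < sexch t i k) svar t i ^+ `|sexch t i k|%N +
     \prod_(i | sexch t i k < 0) svar t i ^+ `|sexch t i k|%N).

Definition mutate t k : seed F n m :=
  Seed (fun i => if i == lshift m k then mutate_var t k else svar t i)
       (mutate_mx k (sexch t)) (sfrozen t).

(* [seed_of t0 t] is t \in \Sigma(A), for A the cluster algebra of the seed t0. *)
Inductive seed_of (t0 : seed F n m) : seed F n m -> Prop :=
| seed_of_refl : seed_of t0 t0
| seed_of_mutate t k : k \notin sfrozen t -> seed_of t0 t ->
    seed_of t0 (mutate t k).

Definition freeze t S : seed F n m :=
  Seed (svar t) (sexch t) (sfrozen t :|: S).

Definition frozen_index t (i : 'I_(n + m)) : bool :=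
  match fintype.split i with inl k => k \in sfrozen t | inr _ => true end.

Definition mutable_arrow t : rel 'I_n := fun i j =>
  [&& i \notin sfrozen t, j \notin sfrozen t & 0 < sexch t (lshift m i) j].

Definition acyclic_quiver t : Prop :=
  forall c : seq 'I_n, cycle (mutable_arrow t) c -> c = [::].

Definition acyclic t0 : Prop :=
  exists2 t, seed_of t0 t & acyclic_quiver t.

End Seeds.

Section ClusterVariety.
Variables (K : fieldType) (n m : nat).
Local Notation F := (ratfun K (n + m)).
Local Notation seed := (seed F n m).
Implicit Types t : seed.

Definition cluster_gens (t0 : seed) : set F :=
  [set x | (exists t i, seed_of t0 t /\ x = svar t i) \/
           (exists i, frozen_index t0 i /\ x = (svar t0 i)^-1)].

Definition cluster_algebra (t0 : seed) := gen_subalg_of (cluster_gens t0).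
HB.instance Definition _ t0 := GRing.ComAlgebra.on (cluster_algebra t0).

Fact svar_cluster_algebra (t0 t : seed) (i : 'I_(n + m)) :
  seed_of t0 t -> svar t i \in gen_subalg (cluster_gens t0).
Proof. by move=> tP; apply: mem_gen_subalg; left; exists t, i. Qed.

Definition cluster_var (t0 t : seed) (tP : seed_of t0 t) (i : 'I_(n + m)) :
    cluster_algebra t0 :=
  GenSubalg (svar_cluster_algebra i tP).

(* K-points of Spec A. For K the complex numbers these are all the closed
   points: A is countably generated and K is uncountable and algebraically
   closed, so the residue field of every maximal ideal is K. *)
Definition cluster_variety (t0 : seed) :=
  {lrmorphism cluster_algebra t0 -> K^o}.

Definition cluster_torus (t0 t : seed) (tP : seed_of t0 t) :
    set (cluster_variety t0) :=
  [set p | forall i, p (cluster_var tP i) != 0].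

Definition deep_locus (t0 : seed) : set (cluster_variety t0) :=
  [set p | ~ exists t (tP : seed_of t0 t), cluster_torus tP p].

Definition cluster_aut (t0 : seed)
    (g : {lrmorphism cluster_algebra t0 -> cluster_algebra t0}) : Prop :=
  bijective g /\
  forall t (tP : seed_of t0 t) i, exists2 c : K, c != 0 &
    g (cluster_var tP i) = c *: cluster_var tP i.

Definition stabilizes (t0 : seed)
    (g : {lrmorphism cluster_algebra t0 -> cluster_algebra t0})
    (p : cluster_variety t0) : Prop :=
  forall a, p (g a) = p a.

Definition stabilizer_locus (t0 : seed) : set (cluster_variety t0) :=
  [set p | exists g, [/\ cluster_aut g, stabilizes g p & exists a, g a != a]].

Definition no_mysterious_points (t0 : seed) : Prop :=
  @stabilizer_locus t0 = @deep_locus t0.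

Definition cluster_localization (t0 t : seed) (S : {set 'I_n}) : Prop :=
  gen_subalg (cluster_gens (freeze t S)) =i
  gen_subalg [set x : F | x \in gen_subalg (cluster_gens t0) \/
                exists2 i, i \in S & x = (svar t (lshift m i))^-1].

(* The points of Spec A that are restrictions to A of points of Spec A_S. *)
Definition cluster_chart (t0 t : seed) (S : {set 'I_n}) :
    set (cluster_variety t0) :=
  [set p | exists q : cluster_variety (freeze t S),
     forall (a : cluster_algebra t0) (b : cluster_algebra (freeze t S)),
       val a = val b -> p a = q b].

Definition locally_acyclic (t0 : seed) : Prop :=
  exists (N : nat) (t : 'I_N -> seed) (S : 'I_N -> {set 'I_n}),
    (forall l, [/\ seed_of t0 (t l), cluster_localization t0 (t l) (S l) &
                   acyclic (freeze (t l) (S l))]) /\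
    (forall p : cluster_variety t0, exists l, cluster_chart (t l) (S l) p).

End ClusterVariety.

Definition row_int_span (p n : nat) (M : 'M[int]_(p, n)) : set 'rV[int]_n :=
  [set v | exists a : 'I_p -> int, v = \sum_i a i *: row i M].

(* Main.v *)
Require Import Defs.
From HB Require Import structures.
From mathcomp Require Import all_boot all_order all_algebra.
From mathcomp Require Import boolp classical_sets reals.
From mathcomp.real_closed Require Import complex.
From mathcomp.multinomials Require Import mpoly.
From mathcomp Require Import ring.
Import Order.TTheory GRing.Theory Num.Theory.
Local Open Scope ring_scope.

Set Implicit Arguments.
Unset Strict Implicit.
Unset Printing Implicit Defensive.

(* If the rows of C2 are integer combinations of the rows of (B; C1), there is an
   algebra morphism phi : A1 -> A2 (a quasi-homomorphism) sending every cluster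
   variable to the corresponding cluster variable times a Laurent monomial in the
   frozen variables. The comorphism q |-> q o phi therefore preserves which cluster
   variables vanish at a point. Both loci only depend on this vanishing pattern and
   on B: for the deep locus this is clear, and an automorphism that fixes a point
   must fix the frozen variables, hence is given by weights c on the mutable
   variables with \prod_i c_i ^ b_ik = 1 for all k; the same weights define an
   automorphism of the other algebra, with the same weights on corresponding
   cluster variables. *)

(** * Positive parts of integers and partial ring homomorphisms *)

Lemma pos_partB (a : int) : pos_part a - pos_part (- a) = a.
Proof.
rewrite /pos_part; have [ge0|lt0] := lerP 0 a.
  by rewrite max_r ?oppr_le0 // subr0.
by rewrite max_l ?sub0r ?opprK // oppr_ge0 ltW.
Qed.

Lemma pos_part_cases (a : int) :
  (pos_part a = a /\ pos_part (- a) = 0) \/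
  (pos_part a = 0 /\ pos_part (- a) = - a).
Proof.
rewrite /pos_part; have [ge0|lt0] := lerP 0 a; [left|right].
  by split; rewrite // max_r // oppr_le0.
by split; rewrite // max_l // oppr_ge0 ltW.
Qed.

(** The graph of a partial ring homomorphism. Totality is not asked for, since substitutions and
    automorphisms of a cluster algebra need only be defined on part of the fraction field. *)
Record ring_relation (E F : nzRingType) (R : E -> F -> Prop) : Prop := RingRelation {
  ring_relation1 : R 1 1;
  ring_relationD : forall x y x' y', R x y -> R x' y' -> R (x + x') (y + y');
  ring_relationM : forall x y x' y', R x y -> R x' y' -> R (x * x') (y * y');
  ring_relation_fun : forall x y y', R x y -> R x y' -> y = y' }.

Lemma ring_relation_prod (E F : comNzRingType) (R : E -> F -> Prop) (I : finType)
    (x : I -> E) (y : I -> F) (RP : ring_relation R) (P : pred I) (e : I -> nat) :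
  (forall i, R (x i) (y i)) ->
  R (\prod_(i | P i) x i ^+ e i) (\prod_(i | P i) y i ^+ e i).
Proof.
move=> Rxy; apply: big_ind2 => [|? ? ? ?|i _]; first exact: ring_relation1.
  exact: ring_relationM.
elim: (e i) => [|l IH]; first exact: ring_relation1.
by rewrite !exprS; apply: ring_relationM.
Qed.

(** * Laurent monomials *)

Section Monomials.
Variables (F : fieldType) (I : finType).
Implicit Types (y d : I -> F) (b : I -> int).

Lemma prod_posE y b :
  \prod_(i | 0 < b i) y i ^+ `|b i|%N = \prod_i y i ^ pos_part (b i).
Proof.
rewrite big_mkcond; apply: eq_bigr => i _; rewrite /pos_part.
by case: ltrP => [lt0|le0]; rewrite ?expr0z // exprnP gtz0_abs.
Qed.

Lemma prod_negE y b :
  \prod_(i | b i < 0) y i ^+ `|b i|%N = \prod_i y i ^ pos_part (- b i).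
Proof.
rewrite -prod_posE; apply: eq_big => i; first by rewrite oppr_gt0.
by rewrite abszN.
Qed.

Lemma prod_expzD y b b' : (forall i, y i != 0) ->
  \prod_i y i ^ (b i + b' i) = (\prod_i y i ^ b i) * (\prod_i y i ^ b' i).
Proof.
by move=> y0; rewrite -big_split; apply: eq_bigr => i _; rewrite expfzDr.
Qed.

Lemma prod_expzN y b : \prod_i y i ^ (- b i) = (\prod_i y i ^ b i)^-1.
Proof. by rewrite -prodfV; apply: eq_bigr => i _; rewrite invr_expz. Qed.

Lemma prod_expzM y b c :
  \prod_i y i ^ (b i * c) = (\prod_i y i ^ b i) ^ c.
Proof.
elim/big_rec2: _ => [|i u v _ ->]; first by rewrite exp1rz.
by rewrite expfzMl exprz_exp.
Qed.

Lemma prod_expz_neq0 y b : (forall i, y i != 0) -> \prod_i y i ^ b i != 0.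
Proof. by move=> y0; apply/prodf_neq0 => i _; rewrite expfz_neq0. Qed.

End Monomials.

Lemma split_lshift m n (i : 'I_m) : fintype.split (lshift n i) = inl i.
Proof. exact: (unsplitK (inl i)). Qed.

Lemma split_rshift m n (i : 'I_n) : fintype.split (rshift m i) = inr i.
Proof. exact: (unsplitK (inr i)). Qed.

(** * Mutation of quasi-homomorphisms *)

Section QuasiStep.
Variables (E F : fieldType) (n m1 m2 : nat).
Variables (s : seed E n m1) (t : seed F n m2) (d : 'I_(n + m1) -> F).

(* d gives the scaling: mutable variables of s go to d i times those of t, the
   frozen variables of s go to d i itself. *)
Definition quasi_image (i : 'I_(n + m1)) : F :=
  d i * (if fintype.split i is inl k then svar t (lshift m2 k) else 1).

(** The factor at [k] is forced by the exchange relation: both of its monomials acquire the same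
    factor, written here with positive exponents, and dividing by [d] at [k] leaves the scaling of
    the new variable. *)
Definition quasi_mutate (k : 'I_n) (i : 'I_(n + m1)) : F :=
  if i == lshift m1 k then
    (d i)^-1 * (\prod_l d l ^ pos_part (sexch s l k)) /
      \prod_j svar t (rshift n j) ^ pos_part (sexch t (rshift n j) k)
  else d i.

Definition frozen_monomial (b : 'I_m2 -> int) : F :=
  \prod_j svar t (rshift n j) ^ b j.

Record quasi_scaling : Prop := QuasiScaling {
  quasi_top : forall i k,
    sexch s (lshift m1 i) k = sexch t (lshift m2 i) k;
  quasi_skew : forall i k,
    sexch t (lshift m2 i) k = - sexch t (lshift m2 k) i;
  quasi_neq0 : forall i, d i != 0;
  (* [s] and [t] have the same yhat_k = \prod_i x_i ^ b_ik under [quasi_image]. *)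
  quasi_balanced : forall k,
    \prod_i d i ^ sexch s i k = frozen_monomial (fun j => sexch t (rshift n j) k) }.

Hypothesis dP : quasi_scaling.
Hypothesis t0 : forall i, svar t i != 0.

Lemma quasi_diag0 k : sexch t (lshift m2 k) k = 0.
Proof.
have /eqP := quasi_skew dP k k; rewrite -addr_eq0 -mulr2n -mulr_natr.
by rewrite mulf_eq0 orbF => /eqP.
Qed.

Lemma quasi_diag0l k : sexch s (lshift m1 k) k = 0.
Proof. by rewrite (quasi_top dP) quasi_diag0. Qed.

Lemma frozen_monomial_neq0 b : frozen_monomial b != 0.
Proof. exact: prod_expz_neq0. Qed.

(** Split the exponents in [quasi_balanced] into positive and negative parts and cross-multiply.
    This lets a common factor be pulled out of both exchange monomials. *)
Lemma quasi_balanced_pos k :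
  (\prod_l d l ^ pos_part (sexch s l k)) /
    frozen_monomial (fun j => pos_part (sexch t (rshift n j) k)) =
  (\prod_l d l ^ pos_part (- sexch s l k)) /
    frozen_monomial (fun j => pos_part (- sexch t (rshift n j) k)).
Proof.
have d0 := quasi_neq0 dP.
apply/eqP; rewrite eqr_div ?frozen_monomial_neq0 //; apply/eqP.
have := quasi_balanced dP k; rewrite /frozen_monomial.
rewrite -(eq_bigr _ (fun i _ => congr1 (exprz (d i)) (pos_partB _))).
rewrite -[RHS](eq_bigr _ (fun j _ => congr1 (exprz (svar t (rshift n j))) (pos_partB _))).
rewrite !prod_expzD // !prod_expzN => /eqP.
rewrite eqr_div ?prod_expz_neq0 // => /eqP ->.
by rewrite mulrC.
Qed.

Lemma quasi_mutate_neq0 k i : quasi_mutate k i != 0.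
Proof.
rewrite /quasi_mutate; case: ifP => _; last exact: quasi_neq0.
by rewrite !mulf_neq0 ?invr_eq0 ?prod_expz_neq0 //; apply: quasi_neq0.
Qed.

(** Column [k] only changes sign, and the altered scaling enters it with exponent 0. In another
    column only the scaling at [k] is new, and the resulting power of [Dp / Fp] compensates for the
    correction terms of mutation. *)
Lemma quasi_balanced_mutate k j :
  \prod_i quasi_mutate k i ^ mutate_mx k (sexch s) i j =
  \prod_l svar t (rshift n l) ^ mutate_mx k (sexch t) (rshift n l) j.
Proof.
have d0 := quasi_neq0 dP.
have [->{j}|jk] := eqVneq j k.
  transitivity (\prod_i d i ^ - sexch s i k).
    apply: eq_bigr => i _; rewrite mxE eqxx orbT /quasi_mutate.
    by case: eqP => // ->; rewrite quasi_diag0l oppr0 !expr0z.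
  rewrite prod_expzN (quasi_balanced dP) -prod_expzN.
  by apply: eq_bigr => l _; rewrite mxE eqxx orbT.
set b := sexch t (lshift m2 k) j.
(* At row [k] this formula gives [b], not the mutated entry [- b]: the inverse of [d] inside
   [quasi_mutate] absorbs the sign, so a uniform product over all [i] remains. *)
pose e i := sexch s i j + pos_part (sexch s i k) * pos_part b
               - pos_part (- sexch s i k) * pos_part (- b).
set Dp := \prod_l d l ^ pos_part (sexch s l k).
set Dn := \prod_l d l ^ pos_part (- sexch s l k).
set Fp := frozen_monomial (fun l => pos_part (sexch t (rshift n l) k)).
set Fn := frozen_monomial (fun l => pos_part (- sexch t (rshift n l) k)).
have Dp0 : Dp != 0 by apply: prod_expz_neq0.
have Dn0 : Dn != 0 by apply: prod_expz_neq0.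
have Fp0 : Fp != 0 by apply: frozen_monomial_neq0.
have Fn0 : Fn != 0 by apply: frozen_monomial_neq0.
have cancel_exp (x y : F) (c : int) : x != 0 -> x ^ c * (x / y) ^ (- c) = y ^ c.
  move=> x0; rewrite expfzMl mulrA -expfzDr // subrr expr0z mul1r.
  by rewrite exprz_inv opprK.
have -> : \prod_i quasi_mutate k i ^ mutate_mx k (sexch s) i j =
          (\prod_i d i ^ e i) * (Dp / Fp) ^ (- b).
  rewrite (bigD1 (lshift m1 k)) //= [in RHS](bigD1 (lshift m1 k)) //=.
  rewrite mxE eqxx /= /quasi_mutate eqxx (quasi_top dP) -/b -/Dp -/(frozen_monomial _) -/Fp.
  have -> : e (lshift m1 k) = b.
    by rewrite /e quasi_diag0l (quasi_top dP) oppr0 /pos_part maxxx !mul0r subr0 addr0.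
  rewrite -[_^-1 * Dp * _]mulrA expfzMl exprz_inv opprK mulrAC.
  congr (_ * _ * _).
  apply: eq_bigr => i ik; rewrite (negPf ik) mxE (negPf ik) (negPf jk) /=.
  by rewrite (quasi_top dP).
rewrite prod_expzD ?prod_expzD // prod_expzN !prod_expzM (quasi_balanced dP) -/Dp -/Dn.
have -> : \prod_l svar t (rshift n l) ^ mutate_mx k (sexch t) (rshift n l) j =
   frozen_monomial (fun l => sexch t (rshift n l) j) * Fp ^ pos_part b /
     Fn ^ pos_part (- b).
  rewrite -!prod_expzM -prod_expzN -!prod_expzD //.
  apply: eq_bigr => l _; rewrite mxE (negPf jk) orbF.
  by rewrite -[rshift n l == _]/(_ == _) eq_rlshift.
rewrite -!mulrA; congr (_ * _).
(* For [b >= 0] only [Dp] and [Fp] survive; otherwise [Dp / Fp] is first replaced by the equal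
   [Dn / Fn]. *)
case: (pos_part_cases b) => -[-> ->]; rewrite !expr0z ?invr1 ?mulr1 ?mul1r.
  exact: cancel_exp.
by rewrite (quasi_balanced_pos k) -/Dn -/Fn !invr_expz opprK cancel_exp.
Qed.

(** The image of the exchange binomial is [Dp * Xp + Dn * Xn], which balance turns into [Dp / Fp]
    times the binomial [Xp * Fp + Xn * Fn] of [t]. *)
Lemma quasi_mutate_var k (y : 'I_(n + m1) -> F) :
  (forall i, y i = quasi_image i) ->
  (\prod_i y i ^ pos_part (sexch s i k) +
     \prod_i y i ^ pos_part (- sexch s i k)) =
  y (lshift m1 k) * (quasi_mutate k (lshift m1 k) * mutate_var t k).
Proof.
move=> yE.
have split_image (b : 'I_(n + m1) -> int) :
  \prod_i y i ^ b i =
  (\prod_i d i ^ b i) * \prod_(i < n) svar t (lshift m2 i) ^ b (lshift m1 i).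
  rewrite !big_split_ord /= mulrAC -big_split /=; congr (_ * _).
    apply: eq_bigr => i _; rewrite yE /quasi_image expfzMl.
    by rewrite split_lshift.
  apply: eq_bigr => i _; rewrite yE /quasi_image.
  by rewrite split_rshift mulr1.
rewrite !split_image /mutate_var prod_posE prod_negE.
rewrite !(big_split_ord _ _ (fun i => svar t i ^ _)) /=.

rewrite yE /quasi_image split_lshift /quasi_mutate eqxx.
have [d0 W] := (quasi_neq0 dP, quasi_balanced_pos k).
have topE (f : int -> int) : \prod_(i < n) svar t (lshift m2 i) ^ f (sexch s (lshift m1 i) k) =
    \prod_(i < n) svar t (lshift m2 i) ^ f (sexch t (lshift m2 i) k).
  by apply: eq_bigr => i _; rewrite (quasi_top dP).
rewrite (topE pos_part) (topE (fun z => pos_part (- z))).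
have := frozen_monomial_neq0 (fun j => pos_part (sexch t (rshift n j) k)).
have := frozen_monomial_neq0 (fun j => pos_part (- sexch t (rshift n j) k)).
move: W; rewrite /frozen_monomial.
set Dp := \prod_l d l ^ pos_part (sexch s l k).
set Dn := \prod_l d l ^ pos_part (- sexch s l k).
set Fp := \prod_j _ ^ pos_part (sexch t (rshift n j) k).
set Fn := \prod_j _ ^ pos_part (- sexch t (rshift n j) k).
rewrite -/Dp -/Dn; set Xp := \prod_j _ ^ pos_part (sexch t (lshift m2 j) k).
set Xn := \prod_j _ ^ pos_part (- sexch t (lshift m2 j) k).
move=> W Fn0 Fp0; have -> : Dn = Dp / Fp * Fn by rewrite W divfK.
have := t0 (lshift m2 k); have := d0 (lshift m1 k).
move: (d _) (svar t _) => a x a0 x0.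
by field; rewrite a0 x0 Fp0.
Qed.

(** Multiplied by the image of the old variable, both sides become the image of the exchange
    binomial, so single-valuedness of [R] and cancellation identify them. *)
Lemma quasi_image_mutate (R : E -> F -> Prop) k z :
  ring_relation R -> svar s (lshift m1 k) != 0 ->
  (forall i, R (svar s i) (quasi_image i)) -> R (mutate_var s k) z ->
  z = quasi_mutate k (lshift m1 k) * mutate_var t k.
Proof.
move=> RP s0 Rs Rz.
have y0 : quasi_image (lshift m1 k) != 0.
  by rewrite mulf_neq0 ?split_lshift //; apply: quasi_neq0.
apply: (mulfI y0); rewrite -quasi_mutate_var // -prod_posE -prod_negE.
have := ring_relationD RP 
  (ring_relation_prod RP (fun i => 0 < sexch s i k) (fun i => `|sexch s i k|%N) Rs)
  (ring_relation_prod RP (fun i => sexch s i k < 0) (fun i => `|sexch s i k|%N) Rs).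
have := ring_relationM RP (Rs (lshift m1 k)) Rz.
rewrite {1}/mutate_var mulVKf //; exact: (ring_relation_fun RP).
Qed.

End QuasiStep.

Lemma quasi_scaling_mutate (E F : fieldType) (n m1 m2 : nat)
    (s : seed E n m1) (t : seed F n m2) (d : 'I_(n + m1) -> F) k :
  quasi_scaling s t d -> (forall i, svar t i != 0) ->
  quasi_scaling (mutate s k) (mutate t k) (quasi_mutate s t d k).
Proof.
move=> dP t0; split=> [i j|i j|i|j].
- by rewrite !mxE !eq_lshift !(quasi_top dP).
- rewrite !mxE !eq_lshift orbC; case: ifP => _; first by rewrite (quasi_skew dP).
  rewrite (quasi_skew dP i j) (quasi_skew dP i k) (quasi_skew dP k j) !opprK.
  by ring.
- exact: quasi_mutate_neq0.
- rewrite quasi_balanced_mutate //; apply: eq_bigr => l _ /=.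
  by rewrite eq_rlshift.
Qed.

(** * Morphisms out of generated subalgebras *)

Section GenSubalg.
Variables (K : fieldType) (F F' : comAlgType K) (G : set F) (G' : set F').

(** [P] lives on the subtype, whereas [gen_subalg] quantifies over predicates on [F]; the induction
    therefore carries membership along with [Q]. *)
Lemma gen_subalg_ind (P : gen_subalg_of G -> Prop) :
  P 1 -> (forall a u v, P u -> P v -> P (a *: u + v)) ->
  (forall u v, P u -> P v -> P (u * v)) ->
  (forall a : gen_subalg_of G, G (val a) -> P a) -> forall a, P a.
Proof.
move=> P1 PZ PM PG a.
pose Q : {pred F} := fun x => `[< forall a, val a = x -> P a >].
have Qval (b : gen_subalg_of G) : val b \in Q -> P b by move/asboolP; apply.
suff /(_ (val a)) aQ : forall x, x \in gen_subalg G -> x \in gen_subalg G /\ x \in Q.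
  by apply: Qval; case: (aQ (valP a)).
move=> x xG; split=> //.
pose Q' : {pred F} := fun x => (x \in gen_subalg G) && (x \in Q).
suff: x \in Q' by case/andP.
have mkQ y (yG : y \in gen_subalg G) : P (GenSubalg yG) -> y \in Q.
  by move=> Py; apply/asboolP => b by_; rewrite (_ : b = GenSubalg yG) //; apply: val_inj.
move/gen_subalgP: xG; apply; last first.
  move=> y Gy; have yG := mem_gen_subalg Gy; apply/andP; split=> //.
  by apply: (mkQ _ yG); apply: PG.
have [c1 cZ cM] := gen_subalg_closed G; split.
- apply/andP; split=> //; apply: (mkQ _ c1).
  by rewrite (_ : GenSubalg _ = 1) //; apply: val_inj.
- move=> k u v /andP[uG /asboolP uQ] /andP[vG /asboolP vQ].
  apply/andP; split; first exact: cZ.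
  apply: (mkQ _ (cZ k _ _ uG vG)).
  by rewrite (_ : GenSubalg _ = k *: GenSubalg uG + GenSubalg vG);
    [apply: PZ; [apply: uQ | apply: vQ] | apply: val_inj].
- move=> u v /andP[uG /asboolP uQ] /andP[vG /asboolP vQ].
  apply/andP; split; first exact: cM.
  apply: (mkQ _ (cM _ _ uG vG)).
  by rewrite (_ : GenSubalg _ = GenSubalg uG * GenSubalg vG);
    [apply: PM; [apply: uQ | apply: vQ] | apply: val_inj].
Qed.

(** Elements with a partner in the target form a subalgebra containing the generators, hence exhaust
    the source. Single-valuedness of [R] makes the chosen partners a morphism. *)
Lemma gen_subalg_morphism (R : F -> F' -> Prop) :
  ring_relation R -> (forall k x y, R x y -> R (k *: x) (k *: y)) ->
  (forall x, G x -> exists2 y, y \in gen_subalg G' & R x y) ->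
  exists phi : {lrmorphism gen_subalg_of G -> gen_subalg_of G'},
    forall a : gen_subalg_of G, R (val a) (val (phi a)).
Proof.
move=> RP RZ RG.
have ex (a : gen_subalg_of G) : {b : gen_subalg_of G' | R (val a) (val b)}.
  apply: cid; apply: (gen_subalg_ind (P := fun a => exists b, R (val a) (val b))) a.
  - by exists 1; apply: ring_relation1.
  - move=> k u v [u' uR] [v' vR]; exists (k *: u' + v').
    by apply: ring_relationD => //; apply: RZ.
  - by move=> u v [u' uR] [v' vR]; exists (u' * v'); apply: ring_relationM.
  - by move=> a /RG [y yG Ry]; exists (GenSubalg yG).
pose phi a := sval (ex a).
have phiR (a : gen_subalg_of G) : R (val a) (val (phi a)) := svalP (ex a).
have phiE (a : gen_subalg_of G) (b : gen_subalg_of G') : R (val a) (val b) -> phi a = b.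
  by move=> Rab; apply/val_inj/(ring_relation_fun RP (phiR a) Rab).
have phiD : zmod_morphism phi.
  move=> a b; apply: phiE; rewrite -!scaleN1r.
  by apply: ring_relationD => //; apply: RZ.
have phiM : monoid_morphism phi.
  split; first by apply: phiE; apply: ring_relation1.
  by move=> a b; apply: phiE; apply: ring_relationM.
have phiZ : scalable phi by move=> k a; apply: phiE; apply: RZ.
by exists (HB.pack_for {lrmorphism gen_subalg_of G -> gen_subalg_of G'} phi
   (GRing.isZmodMorphism.Build _ _ phi phiD)
   (GRing.isMonoidMorphism.Build _ _ phi phiM)
   (GRing.isScalable.Build _ _ _ _ phi phiZ)).
Qed.

End GenSubalg.

(** * Substitution into rational functions as a partial homomorphism *)

Section Specialization.
Variables (K L : fieldType) (N : nat) (h : {rmorphism K -> L}) (u : 'I_N -> L).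

(* A relation rather than a function: the substitution x_i |-> u_i need not extend
   to the whole field, only to fractions whose denominator does not vanish. *)
Definition specialization (x : ratfun K N) (z : L) : Prop :=
  exists f g, [/\ mmap h u g != 0, x = tofrac f / tofrac g
                & z = mmap h u f / mmap h u g].

Lemma mmap_neq0 g : mmap h u g != 0 -> (tofrac g : ratfun K N) != 0.
Proof. by rewrite tofrac_eq0; apply: contraNneq => ->; rewrite rmorph0. Qed.

Lemma specialization_poly f : specialization (tofrac f) (mmap h u f).
Proof. by exists f, 1; rewrite !rmorph1 !divr1; split=> //; apply: oner_neq0. Qed.

Lemma specialization_relation : ring_relation specialization.
Proof.
split.
- by rewrite -(rmorph1 (mmap h u)) -(tofrac1 {mpoly K[N]}); apply: specialization_poly.
- move=> _ _ _ _ [f [g [g0 -> ->]]] [f' [g' [g'0 -> ->]]].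
  exists (f * g' + f' * g), (g * g'); rewrite !(rmorphD, rmorphM) /=; split.
  + by rewrite mulf_neq0.
  + by rewrite addf_div // mmap_neq0.
  + by rewrite addf_div.
- move=> _ _ _ _ [f [g [g0 -> ->]]] [f' [g' [g'0 -> ->]]].
  exists (f * f'), (g * g'); rewrite !rmorphM /=; split.
  + by rewrite mulf_neq0.
  + by rewrite mulf_div.
  + by rewrite mulf_div.
(* Equal fractions cross-multiply to a polynomial identity, to which [mmap] applies. *)
- move=> _ _ _ [f [g [g0 -> ->]]] [f' [g' [g'0 /eqP e ->]]].
  move: e; rewrite eqr_div ?mmap_neq0 // -!rmorphM tofrac_eq => /eqP e.
  by apply/eqP; rewrite eqr_div // -!rmorphM e.
Qed.

Lemma specializationV x z : specialization x z -> z != 0 ->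
  specialization x^-1 z^-1.
Proof.
move=> [f [g [g0 -> ->]]]; rewrite mulf_eq0 invr_eq0 => /norP[f0 _].
by exists g, f; rewrite !invf_div.
Qed.

Lemma specialization_var i : specialization (ratfun_var K i) (u i).
Proof.
by have := specialization_poly 'X_i; rewrite mmapX mmap1U.
Qed.

Lemma specialization_const k : specialization (ratfun_const N k) (h k).
Proof. by have := specialization_poly k%:MP_[N]; rewrite mmapC. Qed.

End Specialization.

(** * Parallel seeds *)

(** The correspondence follows a common sequence of mutations and is not a map on seeds: a priori,
    different sequences may reach the same seed on one side only. *)
Inductive parallel_seeds (E F : fieldType) (n m1 m2 : nat)
    (s0 : seed E n m1) (t0 : seed F n m2) : seed E n m1 -> seed F n m2 -> Prop :=
| parallel_refl : parallel_seeds s0 t0 s0 t0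
| parallel_mutate s t k : parallel_seeds s0 t0 s t ->
    parallel_seeds s0 t0 (mutate s k) (mutate t k).

Section ParallelSeeds.
Variables (E F : fieldType) (n m1 m2 : nat).
Variables (s0 : seed E n m1) (t0 : seed F n m2).

Lemma parallel_sym s t : parallel_seeds s0 t0 s t -> parallel_seeds t0 s0 t s.
Proof. by elim=> [|{}s {}t k _ IH]; constructor. Qed.

Lemma parallel_top s t :
  (forall i k, sexch s0 (lshift m1 i) k = sexch t0 (lshift m2 i) k) ->
  parallel_seeds s0 t0 s t ->
  forall i k, sexch s (lshift m1 i) k = sexch t (lshift m2 i) k.
Proof.
move=> top; elim=> [|{}s {}t k _ IH] //= i j.
by rewrite !mxE !eq_lshift !IH.
Qed.

Hypotheses (s0F : sfrozen s0 = finset.set0) (t0F : sfrozen t0 = finset.set0).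

Lemma seed_of_unfrozen t : seed_of t0 t -> sfrozen t = finset.set0.
Proof. by elim. Qed.

Lemma parallel_seed_of s t : parallel_seeds s0 t0 s t -> seed_of t0 t.
Proof.
elim=> [|{}s {}t k _ IH]; first exact: seed_of_refl.
by apply: seed_of_mutate => //; rewrite seed_of_unfrozen // inE.
Qed.

Lemma seed_of_parallel s : seed_of s0 s -> exists t, parallel_seeds s0 t0 s t.
Proof.
elim=> [|{}s k _ _ [t st]]; first by exists t0; constructor.
by exists (mutate t k); constructor.
Qed.

End ParallelSeeds.

(** * Cluster algebras of initial seeds and their points *)

Section InitialSeed.
Variables (K : numFieldType) (n m : nat) (B : 'M[int]_(n + m, n)).
Local Notation t0 := (initial_seed K B).
Local Notation F := (ratfun K (n + m)).
Local Notation A := (cluster_algebra t0).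

(* Evaluating all initial variables at 1 makes every cluster variable positive. *)
Lemma cluster_var_neq0 t i : seed_of t0 t -> svar t i != 0.
Proof.
pose R := @specialization K K (n + m) idfun (fun=> 1).
have RP : ring_relation R by apply: specialization_relation.
suff pos : seed_of t0 t -> forall i, exists2 z, 0 < z & R (svar t i) z.
  move=> /pos/(_ i)[z z0 Rz]; apply: contraTneq z0 => t0; rewrite t0 in Rz.
  suff -> : z = 0 by rewrite ltxx.
  apply: ring_relation_fun Rz _ => //.
  by rewrite -tofrac0 -(rmorph0 (mmap idfun (fun _ : 'I_(n + m) => 1 : K)));
    apply: specialization_poly.
elim=> [j|{i}{}t k _ _ IH j].
  by exists 1; rewrite ?ltr01 //; apply: specialization_var.
rewrite /=; case: eqP => // _; have [z z_gt0 Rz] := fin_all_exists2 IH.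
have prod_gt0 (P : pred 'I_(n + m)) (e : 'I_(n + m) -> nat) :
  0 < \prod_(i | P i) z i ^+ e i.
  by apply: prodr_gt0 => i _; apply: exprn_gt0.
eexists; last first.
  apply: ring_relationM => //; first by apply: specializationV (Rz _) _; rewrite gt_eqF.
  by apply: ring_relationD => //; apply: ring_relation_prod.
by rewrite mulr_gt0 ?invr_gt0 // addr_gt0.
Qed.

Lemma frozen_var t j : seed_of t0 t ->
  svar t (rshift n j) = ratfun_var K (rshift n j).
Proof. by elim=> [|{}t k _ _ IH] //=; rewrite eq_rlshift. Qed.

Lemma mem_frozen_inv j :
  (ratfun_var K (rshift n j))^-1 \in gen_subalg (cluster_gens t0).
Proof.
by apply: mem_gen_subalg; right; exists (rshift n j); rewrite /frozen_index split_rshift.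
Qed.

Lemma cluster_algebra_ind (P : A -> Prop) :
  P 1 -> (forall a u v, P u -> P v -> P (a *: u + v)) ->
  (forall u v, P u -> P v -> P (u * v)) ->
  (forall t i a, seed_of t0 t -> val a = svar t i -> P a) ->
  (forall j a, val a = (ratfun_var K (rshift n j))^-1 -> P a) -> forall a, P a.
Proof.
move=> P1 PZ PM Pv Pf; apply: gen_subalg_ind => // a [[t [i [tP aE]]]|[i []]].
  exact: Pv tP aE.
rewrite /frozen_index /=; case: split_ordP => j -> {i}; first by rewrite inE.
by move=> _; apply: Pf.
Qed.

Lemma cluster_point_frozen (p : cluster_variety t0) (a : A) j :
  val a = ratfun_var K (rshift n j) -> p a != 0.
Proof.
move=> aE; pose b : A := GenSubalg (mem_frozen_inv j).
have pab : p (a * b) = 1.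
  rewrite -(rmorph1 p); congr (p _); apply: val_inj; rewrite /= aE mulfV //.
  exact: (@cluster_var_neq0 t0 (rshift n j) (seed_of_refl _)).
apply/eqP => pa0; move: pab; rewrite rmorphM /=. rewrite pa0 mul0r => /esym/eqP.
by rewrite oner_eq0.
Qed.

Lemma fix_frozen_inv (f : {lrmorphism A -> A}) j (a : A) :
  (forall b, val b = ratfun_var K (rshift n j) -> f b = b) ->
  val a = (ratfun_var K (rshift n j))^-1 -> f a = a.
Proof.
move=> fixb aE.
pose b : A := cluster_var (seed_of_refl t0) (rshift n j).
have b0 : val b != 0 by apply: cluster_var_neq0 (seed_of_refl _).
have ab : a * b = 1 by apply: val_inj; rewrite /= aE mulVf.
have : f a * b = a * b by rewrite -{1}(fixb b) // -rmorphM ab rmorph1.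
by move/(congr1 val)/(mulIf b0)/val_inj.
Qed.

End InitialSeed.

(** * The quasi-homomorphism attached to a scaling *)

Section QuasiMorphism.
Variables (K : numFieldType) (n m1 m2 : nat).
Variables (B1 : 'M[int]_(n + m1, n)) (B2 : 'M[int]_(n + m2, n)).
Local Notation s0 := (initial_seed K B1).
Local Notation t0 := (initial_seed K B2).
Local Notation F2 := (ratfun K (n + m2)).
Local Notation A2 := (gen_subalg (cluster_gens t0)).

(** Since [0^-1 = 0], this also holds for 0; nonvanishing of scalings is supplied separately by
    [quasi_neq0]. *)
Definition cluster_unit (x : F2) : Prop := (x \in A2) /\ (x^-1 \in A2).

Lemma cluster_unit1 : cluster_unit 1.
Proof. by rewrite /cluster_unit invr1 !rpred1. Qed.

Lemma cluster_unitM x y : cluster_unit x -> cluster_unit y -> cluster_unit (x * y).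
Proof. by case=> xA x'A [yA y'A]; split; rewrite ?invfM rpredM. Qed.

Lemma cluster_unitV x : cluster_unit x -> cluster_unit x^-1.
Proof. by case=> xA x'A; split; rewrite ?invrK. Qed.

Lemma cluster_unitXz x (k : int) : cluster_unit x -> cluster_unit (x ^ k).
Proof.
case: k => k [xA x'A]; split; rewrite /= ?NegzE -?exprnN ?invrK -?exprVn;
  by rewrite ?rpredX // ?exprVn ?invrK -?exprVn rpredX.
Qed.

Lemma cluster_unit_prod (I : finType) (x : I -> F2) (b : I -> int) :
  (forall i, cluster_unit (x i)) -> cluster_unit (\prod_i x i ^ b i).
Proof.
move=> xU; apply: big_ind => [||i _]; first exact: cluster_unit1.
  exact: cluster_unitM.
exact: cluster_unitXz.
Qed.

Lemma cluster_unit_frozen j : cluster_unit (ratfun_var K (rshift n j)).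
Proof.
by split; [apply: (svar_cluster_algebra _ (seed_of_refl t0)) | apply: mem_frozen_inv].
Qed.

Variable d : 'I_(n + m1) -> F2.
Hypotheses (dP : quasi_scaling s0 t0 d) (dU : forall i, cluster_unit (d i)).

Definition quasi_relation : ratfun K (n + m1) -> F2 -> Prop :=
  @specialization K F2 _ (GRing.in_alg F2) (quasi_image t0 d).

(** Induction along the mutations; the scaling varies with the seed, whence the existential. Unit
    scalings persist because [quasi_mutate] only multiplies and inverts units. *)
Lemma quasi_relation_seed s t : parallel_seeds s0 t0 s t ->
  exists e, [/\ quasi_scaling s t e, forall i, cluster_unit (e i)
              & forall i, quasi_relation (svar s i) (quasi_image t e i)].
Proof.
elim=> [|{}s {}t k st [e [eP eU eR]]].
  exists d; split=> [//|//|i]; exact: specialization_var.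
have tP : seed_of t0 t by apply: parallel_seed_of st.
have sP : seed_of s0 s by apply: parallel_seed_of (parallel_sym st).
have t_neq0 i : svar t i != 0 := cluster_var_neq0 i tP.
exists (quasi_mutate s t e k); split.
- exact: quasi_scaling_mutate.
- move=> i; rewrite /quasi_mutate; case: ifP => // _.
  apply: cluster_unitM; first apply: cluster_unitM; try apply: cluster_unitV => //.
    exact: cluster_unit_prod.
  apply: cluster_unit_prod => j; rewrite (frozen_var j tP); exact: cluster_unit_frozen.
- have yk0 : quasi_image t e (lshift m1 k) != 0.
    by rewrite /quasi_image mulf_neq0 ?(quasi_neq0 eP) // split_lshift.
  have RP : ring_relation quasi_relation by apply: specialization_relation.
  (* An image exists because the old variable, the only denominator, has nonzero image; its value is
     then read off from the exchange relation. *)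
  have [z Rz] : exists z, quasi_relation (mutate_var s k) z.
    eexists; apply: ring_relationM => //; first exact: specializationV (eR _) yk0.
    by apply: ring_relationD => //; apply: ring_relation_prod.
  have zE := quasi_image_mutate eP t_neq0 RP (cluster_var_neq0 (lshift m1 k) sP) eR Rz.
  move=> i; rewrite /quasi_image /=.
  case: eqP => [->|/eqP ik].
    by rewrite split_lshift eqxx -zE.
  rewrite /quasi_mutate (negPf ik).
  have := eR i; rewrite /quasi_image; case: split_ordP ik => [l ->|l -> //].
  by rewrite !eq_lshift => /negPf ->.
Qed.

Lemma quasi_morphism :
  exists phi : {lrmorphism cluster_algebra s0 -> cluster_algebra t0},
    forall a, quasi_relation (val a) (val (phi a)).
Proof.
apply: gen_subalg_morphism; first exact: specialization_relation.
  move=> k x y Rxy; rewrite -[k *: y]mulr_algl.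
  apply: ring_relationM Rxy; first exact: specialization_relation.
  exact: specialization_const.
move=> x [[s [i [sP ->]]]|[i []]].
  have [t st] := seed_of_parallel t0 sP.
  have [e [eP eU eR]] := quasi_relation_seed st.
  exists (quasi_image t e i) => //; rewrite /quasi_image rpredM //; first by case: (eU i).
  case: (fintype.split i) => [l|_]; last exact: rpred1.
  by apply: svar_cluster_algebra; apply: parallel_seed_of st.
rewrite /frozen_index /=; case: split_ordP => j -> {i}; first by rewrite inE.
move=> _ ->; exists (d (rshift n j))^-1; first by case: (dU (rshift n j)).
apply: specializationV; last exact: quasi_neq0 dP _.
by have := @specialization_var K F2 _ (GRing.in_alg F2) (quasi_image t0 d) (rshift n j);
  rewrite {2}/quasi_image split_rshift mulr1.
Qed.

End QuasiMorphism.

(** * Automorphisms scaling the mutable variables *)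

Section TorusScaling.
Variables (K : numFieldType) (n m : nat) (B : 'M[int]_(n + m, n)).
Local Notation t0 := (initial_seed K B).
Local Notation F := (ratfun K (n + m)).
Local Notation A := (cluster_algebra t0).
Implicit Types (t : seed F n m) (c : 'I_n -> K) (g : {lrmorphism A -> A}).

(** [quasi_image] keeps no factor of [t] at frozen indices, so the scaling there must be the
    variable itself for frozen variables to be fixed. *)
Definition torus_scaling t c (i : 'I_(n + m)) : F :=
  if fintype.split i is inl k then (c k)%:A else svar t i.

Definition scaled_var t c (i : 'I_(n + m)) : F :=
  if fintype.split i is inl k then c k *: svar t i else svar t i.

Lemma quasi_image_torus t c i :
  quasi_image t (torus_scaling t c) i = scaled_var t c i.
Proof.
rewrite /quasi_image /torus_scaling /scaled_var.
by case: split_ordP => j ->; rewrite ?mulr_algl ?mulr1.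
Qed.

Definition principal_skew (M : 'M[int]_(n + m, n)) : Prop :=
  forall i k, M (lshift m i) k = - M (lshift m k) i.

Lemma in_algXz (x : K) (k : int) : (x ^ k)%:A = (x%:A : F) ^ k.
Proof. exact: (fmorphXz (GRing.in_alg F)). Qed.

Lemma torus_quasi_scaling t c :
  seed_of t0 t -> principal_skew (sexch t) -> (forall i, c i != 0) ->
  (forall k, \prod_i c i ^ sexch t (lshift m i) k = 1) ->
  quasi_scaling t t (torus_scaling t c).
Proof.
move=> tP skew c0 bal; split=> [//|//|i|k].
  rewrite /torus_scaling; case: (fintype.split i) => [l|_]; last exact: cluster_var_neq0 tP.
  by rewrite scaler_eq0 negb_or c0 oner_neq0.
rewrite big_split_ord /= [X in X * _](_ : _ = 1) ?mul1r.
  by apply: eq_bigr => j _; rewrite /torus_scaling split_rshift.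
transitivity ((\prod_i c i ^ sexch t (lshift m i) k)%:A : F); last by rewrite bal scale1r.
rewrite -[RHS]/(GRing.in_alg F _) rmorph_prod; apply: eq_bigr => i _.
by rewrite /torus_scaling split_lshift -in_algXz.
Qed.

Lemma in_algV (x : K) : x^-1%:A = (x%:A : F)^-1.
Proof. exact: (fmorphV (GRing.in_alg F)). Qed.

Definition scaled_by g t c : Prop :=
  quasi_scaling t t (torus_scaling t c) /\
  forall i (a : A), val a = svar t i -> val (g a) = scaled_var t c i.

Definition weight_mutate (M : 'M[int]_(n + m, n)) k c (i : 'I_n) : K :=
  if i == k then (c k)^-1 * \prod_l c l ^ pos_part (M (lshift m l) k) else c i.

Lemma torus_scaling_mutate t c k : seed_of t0 t ->
  quasi_mutate t t (torus_scaling t c) k =1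
  torus_scaling (mutate t k) (weight_mutate (sexch t) k c).
Proof.
move=> tP i; rewrite /quasi_mutate /torus_scaling /=.
case: split_ordP => j ->; last by rewrite eq_rlshift.
rewrite eq_lshift /weight_mutate; case: eqP => // -> {j}.
rewrite big_split_ord /= mulrA.
under [X in _ * X / _]eq_bigr do rewrite split_rshift.
rewrite mulfK; last by apply: prod_expz_neq0 => j; apply: cluster_var_neq0 tP.
rewrite -[RHS]/(GRing.in_alg F _) rmorphM fmorphV rmorph_prod.
by congr (_ * _); apply: eq_bigr => l _; rewrite split_lshift -in_algXz.
Qed.

Lemma scaled_by_mutate g t c k : seed_of t0 t -> seed_of t0 (mutate t k) ->
  scaled_by g t c -> scaled_by g (mutate t k) (weight_mutate (sexch t) k c).
Proof.
move=> tP t'P [cP gt].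
have t_neq0 i : svar t i != 0 := cluster_var_neq0 i tP.
have dE := torus_scaling_mutate c k tP.
split.
  case: (quasi_scaling_mutate k cP t_neq0) => top skew d0 bal.
  split=> // [i|j]; first by rewrite -dE.
  by rewrite -bal; apply: eq_bigr => i _; rewrite dE.
(* The graph of [g] inside [F] is a partial ring homomorphism, so the mutation rule for images
   applies to [g] although it is defined on the subalgebra only. *)
pose R (x y : F) := exists2 a : A, val a = x & val (g a) = y.
have RP : ring_relation R.
  split.
  - by exists 1; rewrite ?rmorph1.
  - by move=> _ _ _ _ [a <- <-] [b <- <-]; exists (a + b); rewrite ?rmorphD.
  - by move=> _ _ _ _ [a <- <-] [b <- <-]; exists (a * b); rewrite ?rmorphM.
  - by move=> _ _ _ [a <- <-] [b /val_inj -> <-].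
have Rt i : R (svar t i) (quasi_image t (torus_scaling t c) i).
  by rewrite quasi_image_torus; exists (cluster_var tP i); last exact: gt.
move=> i a aE; rewrite -quasi_image_torus /quasi_image -dE.
have [ik|ik] := eqVneq i (lshift m k).
  have Rz : R (mutate_var t k) (val (g a)) by exists a; rewrite // aE ik /= eqxx.
  rewrite (quasi_image_mutate cP t_neq0 RP (t_neq0 _) Rt Rz) ik split_lshift /=.
  by rewrite eqxx.
move: aE; rewrite /= (negPf ik) => /gt ->.
rewrite -quasi_image_torus /quasi_image /quasi_mutate (negPf ik).
by case: split_ordP ik => l -> //; rewrite !eq_lshift => /negPf ->.
Qed.

(** Trivial weights stay trivial under [weight_mutate], so every cluster variable is fixed. *)
Lemma fix_cluster_algebra g : principal_skew B ->
  (forall i (a : A), val a = svar t0 i -> g a = a) -> forall a, g a = a.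
Proof.
move=> skew fix0.
suff fix_vars t : seed_of t0 t -> exists2 c, c =1 (fun=> 1) & scaled_by g t c.
  apply: cluster_algebra_ind.
  - by rewrite rmorph1.
  - by move=> k u v gu gv; rewrite linearP /= gu gv.
  - by move=> u v gu gv; rewrite rmorphM /= gu gv.
  - move=> t i a /fix_vars[c c1 [_ /(_ i a) gt]] aE; apply: val_inj.
    rewrite gt // /scaled_var aE.
    by case: (fintype.split i) => // k; rewrite c1 scale1r.
  - by move=> j a aE; apply: fix_frozen_inv aE => b; apply: fix0.
elim=> [|{}t k kP tP [c c1 cP]].
  exists (fun=> 1) => //; split.
    apply: torus_quasi_scaling => //; first exact: seed_of_refl.
      by move=> i; apply: oner_neq0.
    by move=> k; apply: big1 => i _; rewrite exp1rz.
  move=> i a aE; rewrite (fix0 i) // aE /scaled_var.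
  by case: (fintype.split i) => // k; rewrite scale1r.
exists (weight_mutate (sexch t) k c); last first.
  by apply: scaled_by_mutate => //; apply: seed_of_mutate.
move=> i; rewrite /weight_mutate; case: eqP => [_|_]; last exact: c1.
by rewrite c1 invr1 mul1r big1 // => l _; rewrite c1 exp1rz.
Qed.

(** A quasi-homomorphism from the algebra to itself: nonzero constants and frozen variables are
    units. *)
Lemma torus_morphism c : principal_skew B -> (forall i, c i != 0) ->
  (forall k, \prod_i c i ^ B (lshift m i) k = 1) ->
  exists g, scaled_by g t0 c.
Proof.
move=> skew c0 bal.
have cP : quasi_scaling t0 t0 (torus_scaling t0 c).
  by apply: torus_quasi_scaling => //; apply: seed_of_refl.
have cU i : cluster_unit B (torus_scaling t0 c i).
  rewrite /torus_scaling; case: split_ordP => j iE.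
    by split; rewrite -?in_algV rpredZ ?rpred1.
  by rewrite iE; apply: cluster_unit_frozen.
have [g gR] := quasi_morphism cP cU; exists g; split=> // i a aE.
have := gR a; rewrite aE => Rg.
rewrite -quasi_image_torus.
apply: (ring_relation_fun _ Rg (specialization_var _ _ _)).
exact: specialization_relation.
Qed.

End TorusScaling.

(** * Weights of an automorphism that fixes a point *)

Section Weights.
Variables (K : numFieldType) (n m : nat) (B : 'M[int]_(n + m, n)).
Local Notation t0 := (initial_seed K B).
Local Notation F := (ratfun K (n + m)).
Local Notation A := (cluster_algebra t0).

Lemma cluster_valZ (x : K) (a : A) : val (x *: a) = x *: val a.
Proof. by []. Qed.

Lemma cluster_valD (a b : A) : val (a + b) = val a + val b.
Proof. by []. Qed.

Lemma mutation_monomials_independent (k : 'I_n) (x y : K) :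
  x *: (\prod_(i | 0 < B i k) ratfun_var K i ^+ `|B i k|%N) +
  y *: (\prod_(i | B i k < 0) ratfun_var K i ^+ `|B i k|%N) = 0 :> F ->
  (x = 0 /\ y = 0) \/ forall i, B i k = 0.
Proof.
pose mon (P : pred 'I_(n + m)) := [multinom (if P i then `|B i k|%N else 0%N) | i < n + m].
have monE (P : pred 'I_(n + m)) :
  \prod_(i | P i) ratfun_var K i ^+ `|B i k|%N = tofrac 'X_[mon P] :> F.
  rewrite mpolyXE_id (rmorph_prod (@tofrac {mpoly K[n + m]})) big_mkcond.
  apply: eq_bigr => i _; rewrite (rmorphXn (@tofrac {mpoly K[n + m]})) mnmE.
  by case: (P i).
rewrite !monE => /eqP; rewrite -[_ *: _]/(tofrac _%:MP * _) -[y *: _]/(tofrac _%:MP * _).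
rewrite -!tofracM -tofracD tofrac_eq0 => /eqP e.
(* The two exponent vectors have disjoint supports, so they coincide only when the column vanishes;
   otherwise coefficients can be compared. *)
have [mE|mE] := eqVneq (mon (fun i => 0 < B i k)) (mon (fun i => B i k < 0)).
  right=> i; move/mnmP/(_ i): mE; rewrite !mnmE.
  by case: ltrgt0P => // _ /eqP; rewrite ?absz_eq0 1?eq_sym ?absz_eq0 => /eqP.
left; split.
  have := congr1 (mcoeff (mon (fun i => 0 < B i k))) e.
  by rewrite mcoeffD !mcoeffCM !mcoeffX mcoeff0 eqxx eq_sym (negPf mE) mulr1 mulr0 addr0.
have := congr1 (mcoeff (mon (fun i => B i k < 0))) e.
by rewrite mcoeffD !mcoeffCM !mcoeffX mcoeff0 eqxx (negPf mE) mulr1 mulr0 add0r.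
Qed.

Lemma stabilizer_weights (g : {lrmorphism A -> A}) (p : cluster_variety t0) :
  principal_skew B -> cluster_aut g -> stabilizes g p ->
  exists c, [/\ forall i, c i != 0,
    forall k, \prod_i c i ^ B (lshift m i) k = 1 & scaled_by g t0 c].
Proof.
move=> skew [_ gscal] gp.
have refl : seed_of t0 t0 by apply: seed_of_refl.
have [e e0 ge] := fin_all_exists2 (gscal t0 refl).
(* [p] is nonzero on frozen variables and unchanged by [g], which forces weight 1. *)
have eF j : e (rshift n j) = 1.
  have px := @cluster_point_frozen _ _ _ _ p (cluster_var refl (rshift n j)) j erefl.
  apply: (mulIf px); rewrite mul1r -[RHS]gp ge linearZ /=; exact: erefl.
(* Under [g] the exchange relation is scaled by one constant on the left and by [ep Pp] and [ep Pn]
   on the two monomials. Independence equates these factors, unless the column is zero and the claim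
   is trivial. *)
have bal k : \prod_i e i ^ B i k = 1.
  have t1P : seed_of t0 (mutate t0 k) by apply: seed_of_mutate (refl); rewrite inE.
  have [e' e'0 ge'] := gscal _ t1P (lshift m k).
  pose X (P : pred 'I_(n + m)) : A := \prod_(i | P i) cluster_var refl i ^+ `|B i k|%N.
  pose ep (P : pred 'I_(n + m)) : K := \prod_(i | P i) e i ^+ `|B i k|%N.
  have valX P : val (X P) = \prod_(i | P i) ratfun_var K i ^+ `|B i k|%N.
    by rewrite rmorph_prod; apply: eq_bigr => i _; rewrite rmorphXn.
  have gX P : g (X P) = ep P *: X P.
    rewrite rmorph_prod -scaler_prod; apply: eq_bigr => i _.
    by rewrite rmorphXn /= ge exprZn.
  pose Pp i := 0 < B i k; pose Pn i := B i k < 0.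
  have exchange : cluster_var refl (lshift m k) * cluster_var t1P (lshift m k) = X Pp + X Pn.
    apply: val_inj; rewrite rmorphD /= !valX /= eqxx mulVKf //.
    exact: (cluster_var_neq0 _ refl).
  have := congr1 g exchange; rewrite rmorphM rmorphD /= ge ge' !gX.
  rewrite -scalerAl -scalerAr scalerA exchange scalerDr => /(congr1 val).
  rewrite !cluster_valD !cluster_valZ !valX => /eqP.
  rewrite -subr_eq0 opprD addrACA -!scalerBl.
  move=> /eqP/mutation_monomials_independent[[/subr0_eq ep_ /subr0_eq en_]|Bk0].
    rewrite -(eq_bigr _ (fun i _ => congr1 (exprz (e i)) (pos_partB _))).
    rewrite prod_expzD // prod_expzN -prod_posE -prod_negE -/(ep Pp) -/(ep Pn).
    rewrite -ep_ -en_ divff // mulf_neq0 //.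
  by apply: big1 => i _; rewrite Bk0 expr0z.
pose c i := e (lshift m i); exists c.
have balc k : \prod_i c i ^ B (lshift m i) k = 1.
  have := bal k; rewrite big_split_ord /= [X in _ * X]big1 ?mulr1 // => j _.
  by rewrite eF exp1rz.
have c0 i : c i != 0 := e0 _.
split=> //; split; first exact: torus_quasi_scaling (refl) _ _ _.
move=> i a aE; have -> : a = cluster_var refl i by apply: val_inj.
rewrite ge /= /scaled_var; case: split_ordP => j -> //.
by rewrite eF scale1r.
Qed.

End Weights.

(** * Transfer of the deep and stabilizer loci *)

Section Transfer.
Variables (K : numFieldType) (n m1 m2 : nat).
Variables (B1 : 'M[int]_(n + m1, n)) (B2 : 'M[int]_(n + m2, n)).
Local Notation s0 := (initial_seed K B1).
Local Notation t0 := (initial_seed K B2).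
Local Notation A1 := (cluster_algebra s0).
Local Notation A2 := (cluster_algebra t0).

Definition same_vanishing (p : cluster_variety s0) (q : cluster_variety t0) : Prop :=
  forall s t, parallel_seeds s0 t0 s t -> forall (i : 'I_n) (a : A1) (b : A2),
    val a = svar s (lshift m1 i) -> val b = svar t (lshift m2 i) ->
    (p a == 0) = (q b == 0).

Hypothesis top : forall i k, B1 (lshift m1 i) k = B2 (lshift m2 i) k.

(** A cluster torus through [q] would yield one through [p] at a parallel seed. *)
Lemma deep_locus_transfer (p : cluster_variety s0) (q : cluster_variety t0) :
  same_vanishing p q -> deep_locus p -> deep_locus q.
Proof.
move=> pq pD [t [tP qt]]; apply: pD.
have [s ts] := seed_of_parallel s0 tP.
have st := parallel_sym ts.
have sP : seed_of s0 s by apply: parallel_seed_of ts.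
exists s, sP => i; case: (split_ordP i) => j -> {i}.
  by rewrite (pq _ _ st j _ (cluster_var tP (lshift m2 j))) //; apply: qt.
by apply: (cluster_point_frozen p (j := j)); rewrite /= (frozen_var _ sP).
Qed.

Lemma stabilizer_locus_transfer (p : cluster_variety s0) (q : cluster_variety t0) :
  principal_skew B1 -> same_vanishing p q ->
  stabilizer_locus p -> stabilizer_locus q.
Proof.
move=> skew1 pq [g [gaut gp [a0 ga0]]].
have skew2 : principal_skew B2 by move=> i k; rewrite -!top skew1.
have [c [c0 bal1 gc]] := stabilizer_weights skew1 gaut gp.
have bal2 k : \prod_i c i ^ B2 (lshift m2 i) k = 1.
  by rewrite -[RHS](bal1 k); apply: eq_bigr => i _; rewrite top.
have [h hc] := torus_morphism skew2 c0 bal2.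
(* Inverse weights satisfy the same relations and provide the inverse of [h]. *)
have [h' hc'] : exists h' : {lrmorphism A2 -> A2}, scaled_by h' t0 (fun i => (c i)^-1).
  apply: (torus_morphism (c := fun i => (c i)^-1)) => // [i|k]; first by rewrite invr_eq0.
  by under eq_bigr do rewrite -expfV; rewrite prodfV bal2 invr1.
have cancel_weights (f f' : {lrmorphism A2 -> A2}) (x y : 'I_n -> K) :
    (forall i, x i * y i = 1) -> scaled_by f t0 x -> scaled_by f' t0 y -> cancel f f'.
  move=> xy [_ fx] [_ fy]; apply: (fix_cluster_algebra (g := f' \o f)) => // i a aE /=.
  have fy_a := fy i a aE.
  move: (fx i a aE) fy_a; rewrite /scaled_var -aE.
  case: split_ordP => k _ fxa fya; last by rewrite (val_inj fxa); apply: val_inj.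
  have -> : f a = x k *: a by apply: val_inj; rewrite fxa linearZ.
  by apply: val_inj; rewrite linearZ /= fya scalerA xy scale1r.
(* [g] and [h] act with identical weights at parallel seeds, since weights mutate through the common
   principal part. *)
have scal s t : parallel_seeds s0 t0 s t ->
    exists w, [/\ forall i, w i != 0, scaled_by g s w & scaled_by h t w].
  elim=> [|{}s {}t k st [w [w0 gw hw]]]; first by exists c.
  have tP : seed_of t0 t by apply: parallel_seed_of st.
  have sP : seed_of s0 s by apply: parallel_seed_of (parallel_sym st).
  exists (weight_mutate (sexch s) k w); split.
  - move=> i; rewrite /weight_mutate; case: ifP => // _.
    by rewrite mulf_neq0 ?invr_eq0 // prod_expz_neq0.
  - apply: scaled_by_mutate => //; apply: seed_of_mutate sP.
    by rewrite (seed_of_unfrozen (t0 := s0)) ?inE //; apply: parallel_seed_of (parallel_sym st).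
  - have -> : weight_mutate (sexch s) k w = weight_mutate (sexch t) k w.
      apply: funext => i; rewrite /weight_mutate; case: eqP => // _; congr (_ * _).
      by apply: eq_bigr => l _; rewrite (parallel_top (s0 := s0) (t0 := t0) top st).
    apply: scaled_by_mutate => //; apply: seed_of_mutate (tP).
    by rewrite (seed_of_unfrozen (t0 := t0)) ?inE.
have scal_t t : seed_of t0 t -> exists s w, [/\ parallel_seeds s0 t0 s t,
    forall i, w i != 0, scaled_by g s w & scaled_by h t w].
  move=> /(seed_of_parallel s0)[s /parallel_sym st].
  by have [w [w0 gw hw]] := scal _ _ st; exists s, w.
exists h; split.
- split.
    exists h'; [apply: cancel_weights hc hc' | apply: cancel_weights hc' hc] => i.
      exact: mulfV.
    exact: mulVf.
  move=> t tP i; have [s [w [_ w0 _ [_ hw]]]] := scal_t _ tP.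
  have := hw i (cluster_var tP i) erefl; rewrite /scaled_var.
  case: split_ordP => k ik hE.
    by exists (w k) => //; apply: val_inj; rewrite hE linearZ.
  by exists 1; [apply: oner_neq0 | apply: val_inj; rewrite hE linearZ /= scale1r].
- apply: cluster_algebra_ind.
  + by rewrite rmorph1.
  + by move=> k u v hu hv; rewrite (linearP h) !(linearP q) /= hu hv.
  + by move=> u v hu hv; rewrite (rmorphM h) !(rmorphM q) /= hu hv.
  + move=> t i b tP bE; have [s [w [st w0 [_ gw] [_ hw]]]] := scal_t _ tP.
    have sP : seed_of s0 s by apply: parallel_seed_of (parallel_sym st).
    have := hw i b bE; rewrite /scaled_var; case: split_ordP => k ik hb; last first.
      by congr (q _); apply: val_inj; rewrite hb bE.
    have -> : h b = w k *: b by apply: val_inj; rewrite hb linearZ /= bE.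
    pose a : A1 := cluster_var sP (lshift m1 k).
    have : p (w k *: a) = p a.
      rewrite -[RHS]gp; congr (p _); apply: val_inj; rewrite (gw (lshift m1 k)) //.
      by rewrite /scaled_var split_lshift linearZ.
    rewrite linearZ /= => pa; rewrite linearZ /=.
    (* If [b] vanishes at [q], scaling changes nothing. Otherwise [a] does not vanish at [p], and
       since [g] fixes [p] the weight [w k] is 1. *)
    have [qb0|qb0] := eqVneq (q b) 0; first by rewrite qb0 scaler0.
    have pa0 : p a != 0 by rewrite (pq s t st k a b) // bE ik.
    have /(mulIf pa0) -> : w k * p a = 1 * p a by rewrite mul1r.
    by rewrite scale1r.
  + move=> j b bE; congr (q _); apply: fix_frozen_inv bE => a aE.
    have [_ /(_ (rshift n j) a aE)] := hc.
    by rewrite /scaled_var split_rshift /= -aE => /val_inj.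
(* Were all weights 1, [g] would be the identity. A weight different from 1 makes [h] move the
   initial variable it belongs to. *)
- have [i ci] : exists i, c i != 1.
    apply: contrapT => c1; case/eqP: ga0; apply: fix_cluster_algebra => // i a aE.
    have [_ /(_ i a aE)] := gc; rewrite /scaled_var -aE => ga; apply: val_inj.
    rewrite ga; case: (fintype.split i) => // k.
    suff -> : c k = 1 by rewrite scale1r.
    by apply: contrapT => /eqP ck; apply: c1; exists k.
  pose refl := seed_of_refl t0.
  exists (cluster_var refl (lshift m2 i)).
  have [_ /(_ (lshift m2 i) (cluster_var refl _) erefl)] := hc.
  rewrite /scaled_var split_lshift => hE; apply: contra ci => /eqP/(congr1 val).
  rewrite hE /= -[in RHS](scale1r (ratfun_var _ _)) => /eqP.
  rewrite -subr_eq0 -scalerBl scaler_eq0 subr_eq0 => /orP[//|].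
  by have := cluster_var_neq0 (lshift m2 i) refl => /negPf ->.
Qed.

End Transfer.

(** * Matching points of the two varieties, and the conclusion *)

Lemma same_vanishing_sym (K : numFieldType) (n m1 m2 : nat)
    (B1 : 'M[int]_(n + m1, n)) (B2 : 'M[int]_(n + m2, n))
    (p : cluster_variety (initial_seed K B1)) (q : cluster_variety (initial_seed K B2)) :
  same_vanishing p q -> same_vanishing q p.
Proof. by move=> pq s t /parallel_sym st i a b aE bE; rewrite (pq _ _ st i b a). Qed.

(** Compose [q] with the quasi-homomorphism: a mutable cluster variable goes to a unit times its
    counterpart, and [q] is nonzero on units. *)
Lemma same_vanishing_pullback (K : numFieldType) (n m1 m2 : nat)
    (B1 : 'M[int]_(n + m1, n)) (B2 : 'M[int]_(n + m2, n)) d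
    (q : cluster_variety (initial_seed K B2)) :
  quasi_scaling (initial_seed K B1) (initial_seed K B2) d ->
  (forall i, cluster_unit B2 (d i)) ->
  exists p : cluster_variety (initial_seed K B1), same_vanishing p q.
Proof.
move=> dP dU; have [phi phiR] := quasi_morphism dP dU.
exists (q \o phi) => s t st i a b aE bE /=.
have [e [eP eU eR]] := quasi_relation_seed dP dU st.
have [eA e'A] := eU (lshift m1 i).
pose u : cluster_algebra (initial_seed K B2) := GenSubalg eA.
pose u' : cluster_algebra (initial_seed K B2) := GenSubalg e'A.
have -> : phi a = u * b.
  apply: val_inj; have := phiR a; rewrite aE => Ra.
  rewrite (ring_relation_fun (specialization_relation _ _) Ra (eR _)).
  by rewrite /quasi_image split_lshift /= bE.
have uu' : u * u' = 1 by apply: val_inj; rewrite /= mulfV // (quasi_neq0 eP).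
have qu0 : q u != 0.
  apply/eqP => qu0; have := congr1 q uu'; rewrite rmorphM rmorph1 /= qu0 mul0r.
  by move=> /esym/eqP; rewrite oner_eq0.
by rewrite rmorphM mulf_eq0 (negPf qu0).
Qed.

(** Row [j] of [C2] is a combination of the rows of [col_mx B C1] with coefficients [a j]. Using
    [a j i] as the exponent of the [j]-th frozen variable in [d i] turns these row identities, read
    at entry [k], into the balance condition. *)
Lemma row_span_quasi_scaling (K : numFieldType) (n m1 m2 : nat)
    (B : 'M[int]_n) (C1 : 'M[int]_(m1, n)) (C2 : 'M[int]_(m2, n)) :
  B^T = - B -> (row_int_span (col_mx B C2) `<=` row_int_span (col_mx B C1))%classic ->
  exists d, quasi_scaling (initial_seed K (col_mx B C1)) (initial_seed K (col_mx B C2)) d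
    /\ forall i, cluster_unit (col_mx B C2) (d i).
Proof.
move=> skew span.
have /fin_all_exists[a aE] (j : 'I_m2) : exists a : 'I_(n + m1) -> int,
    row j C2 = \sum_i a i *: row i (col_mx B C1).
  apply: span; exists (fun i => (i == rshift n j)%:R).
  rewrite (bigD1 (rshift n j)) //= eqxx scale1r big1 ?addr0 ?rowKd //.
  by move=> i /negPf ->; rewrite scale0r.
have x0 j : ratfun_var K (rshift n j : 'I_(n + m2)) != 0.
  exact: (cluster_var_neq0 (rshift n j) (seed_of_refl (initial_seed K (col_mx B C2)))).
exists (fun i => \prod_j ratfun_var K (rshift n j) ^ a j i).
split=> [|i]; last by apply: cluster_unit_prod => j; apply: cluster_unit_frozen.
split=> [i k|i k|i|k] /=.
- by rewrite !col_mxEu.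
- rewrite !col_mxEu; have /matrixP/(_ k i) := skew.
  by rewrite !mxE => <-.
- exact: prod_expz_neq0.
- transitivity (\prod_i \prod_j ratfun_var K (rshift n j : 'I_(n + m2)) ^ (a j i * col_mx B C1 i k)).
    by apply: eq_bigr => i _; rewrite prod_expzM.
  rewrite exchange_big; apply: eq_bigr => j _ /=.
  rewrite col_mxEd; have /rowP/(_ k) := aE j; rewrite summxE mxE => ->.
  elim/big_rec2: _ => [|i u v _ ->]; first by rewrite expr0z.
  by rewrite expfzDr // !mxE.
Qed.

(** Each point [q] has a partner [p] with the same vanishing pattern: pass from [q] to [p], exchange
    the two loci there by hypothesis, and return. *)
Lemma no_mysterious_points_transfer (K : numFieldType) (n m1 m2 : nat)
    (B : 'M[int]_n) (C1 : 'M[int]_(m1, n)) (C2 : 'M[int]_(m2, n)) :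
  B^T = - B -> (row_int_span (col_mx B C2) `<=` row_int_span (col_mx B C1))%classic ->
  no_mysterious_points (initial_seed K (col_mx B C1)) ->
  no_mysterious_points (initial_seed K (col_mx B C2)).
Proof.
move=> skew span nm1; rewrite /no_mysterious_points; apply/seteqP.
have [d [dP dU]] := row_span_quasi_scaling K skew span.
have top i k : col_mx B C1 (lshift m1 i) k = col_mx B C2 (lshift m2 i) k.
  by rewrite !col_mxEu.
have top' i k := esym (top i k).
have skew2 : principal_skew (col_mx B C2) by apply: quasi_skew dP.
have skew1 : principal_skew (col_mx B C1) by move=> i k; rewrite !top skew2.
split=> q; have [p pq] := same_vanishing_pullback q dP dU; have qp := same_vanishing_sym pq.
- move=> /(stabilizer_locus_transfer top' skew2 qp).
  by rewrite nm1; apply: deep_locus_transfer.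
- move=> /(deep_locus_transfer qp); rewrite -nm1.
  exact: stabilizer_locus_transfer.
Qed.

Theorem proposition3p16 (R : realType) (n m1 m2 : nat)
    (B : 'M[int]_n) (C1 : 'M[int]_(m1, n)) (C2 : 'M[int]_(m2, n)) :
  B^T = - B ->
  locally_acyclic (initial_seed R[i] (col_mx B C1)) ->
  locally_acyclic (initial_seed R[i] (col_mx B C2)) ->
  row_int_span (col_mx B C1) = row_int_span (col_mx B C2) ->
  no_mysterious_points (initial_seed R[i] (col_mx B C1)) <->
  no_mysterious_points (initial_seed R[i] (col_mx B C2)).
Proof.
move=> skew _ _ span.
by split; apply: (@no_mysterious_points_transfer R[i]) => //; rewrite span.
Qed.
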